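(* Let $G$ be a simple graph with no isolated vertex. If $G$ is a class II graph and $E(G)$ has a partition into maximum matchings of $G$, then $\Delta(G)$ is even and $G$ is the graph with exactly $\frac{2\nu(G)}{\Delta(G)}$ components, each isomorphic to $K_{\Delta(G)+1}$, the complete graph of order $\Delta(G)+1$.
   Context: All graphs are finite. A simple graph has no loops and no multiple edges. $E(G)$ is the edge set of $G$, $\Delta(G)$ is the maximum degree of a vertex of $G$, $\nu(G)$ is the size (number of edges) of a maximum matching in $G$, and $\chi'(G)$ is the edge chromatic index (the least number of colors in a proper edge coloring). By Vizing's theorem, $\Delta(G)\le\chi'(G)\leq\Delta(G)+1$ for a simple graph; $G$ is in class I if $\chi'(G)=\Delta(G)$ and in class II if $\chi'(G)=\Delta(G)+1$. A maximum matching of $G$ is a matching of size $\nu(G)$. *)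

(* Defs.v *)
From HB Require Import structures.
From mathcomp Require Import all_boot all_order all_algebra.

Set Implicit Arguments.
Unset Strict Implicit.
Unset Printing Implicit Defensive.

Record sgraph := SGraph {
  vertex :> finType;
  adj : rel vertex;
  adj_sym : symmetric adj;
  adj_irrefl : irreflexive adj
}.

Arguments adj {s} x y.

Section Graph.
Variable G : sgraph.

Definition no_isolated_vertex : Prop := forall x : G, exists y : G, adj x y.

Definition degree (x : G) : nat := #|[set y | adj x y]|.

Definition max_degree : nat := \max_(x : G) degree x.

Definition edges : {set {set G}} :=
  [set f | [exists x, exists y, adj x y && (f == [set x; y])]].

Definition is_matching (M : {set {set G}}) : bool :=
  (M \subset edges) && trivIset M.

Definition matching_number : nat :=
  \max_(M : {set {set G}} | is_matching M) #|M|.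

Definition is_maximum_matching (M : {set {set G}}) : bool :=
  is_matching M && (#|M| == matching_number).

(* Colors are assigned to edges only, so an edgeless graph is 0-colorable. *)
Definition edge_colorable (k : nat) : bool :=
  [exists c : {ffun {f : {set G} | f \in edges} -> 'I_k},
    [forall f : {f | f \in edges}, [forall g : {g | g \in edges},
      (f != g) && ~~ [disjoint val f & val g] ==> (c f != c g)]]].

Lemma edge_colorable_exists : exists k, edge_colorable k.
Proof.
exists #|{: {f : {set G} | f \in edges}}|; apply/existsP.
exists [ffun f => enum_rank f]; apply/forallP => f; apply/forallP => g.
apply/implyP => /andP[neq_fg _]; rewrite !ffunE.
by rewrite (inj_eq enum_rank_inj).
Qed.

Definition chromatic_index : nat := ex_minn edge_colorable_exists.

Definition class_II : Prop := chromatic_index = max_degree.+1.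

Definition components : {set {set G}} :=
  equivalence_partition (connect (@adj G)) [set: G].

Variable S : {set G}.

Definition induced_adj : rel {x : G | x \in S} :=
  fun x y => adj (val x) (val y).

Lemma induced_adj_sym : symmetric induced_adj.
Proof. by move=> x y; apply: adj_sym. Qed.

Lemma induced_adj_irrefl : irreflexive induced_adj.
Proof. by move=> x; apply: adj_irrefl. Qed.

Definition induced : sgraph := SGraph induced_adj_sym induced_adj_irrefl.

End Graph.

Definition complete_adj (n : nat) : rel 'I_n := fun i j => i != j.

Lemma complete_adj_sym n : symmetric (@complete_adj n).
Proof. by move=> i j; rewrite /complete_adj eq_sym. Qed.

Lemma complete_adj_irrefl n : irreflexive (@complete_adj n).
Proof. by move=> i; rewrite /complete_adj eqxx. Qed.

Definition complete_graph (n : nat) : sgraph :=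
  SGraph (@complete_adj_sym n) (@complete_adj_irrefl n).

Definition isomorphic (G H : sgraph) : Prop :=
  exists2 f : G -> H, bijective f & forall x y, adj (f x) (f y) = adj x y.

(* Main.v *)
Require Import Defs.
From HB Require Import structures.
From mathcomp Require Import all_boot all_order all_algebra.
From mathcomp Require Import zify.

Set Implicit Arguments.
Unset Strict Implicit.
Unset Printing Implicit Defensive.

(** Let [P] be the partition, [k] its number of parts and [D] the maximum degree.
    Giving each edge the part containing it is a proper edge coloring, so a
    class II graph has [k > D]. The parts covering a vertex correspond to its
    edges, so every vertex is missed by some part, hence by some maximum matching.

    Now Gallai's lemma applies: if every vertex of a graph is missed by a maximum
    matching, then no maximum matching misses two vertices of one component
    ([connect_never_missed_together]). The point is that never being missed
    together is a transitive relation ([never_missed_together_trans]), and that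
    adjacent vertices are in it, since the edge between two missed vertices could
    be added to the matching.

    A matching covers an even number of vertices of each component, and this
    forces every component [C] to be odd and to lose exactly one vertex to each
    part ([component_missed_once]). Counting pairs of a vertex of [C] and a part
    that misses it, the total is therefore [k]. On the other hand a vertex of [C]
    is missed by [k] minus its degree parts, a number at least [1] and at least
    [k + 1 - #|C|]. These estimates leave only [#|C| = k] with all degrees equal
    to [k - 1] ([component_card], [component_degree]), so [C] is complete,
    [D = k - 1], and [D] is even because [#|C|] is odd. Finally a part covers [D]
    of the [D + 1] vertices of each component, and twice the matching number in
    all, which gives the number of components. *)

(** * Matchings *)

Section Matchings.
Variable G : sgraph.
Implicit Types (M N : {set {set G}}) (x y t u v : G).

Lemma edgesP (f : {set G}) :
  reflect (exists x y, adj x y /\ f = [set x; y]) (f \in edges G).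
Proof.
rewrite inE; apply: (iffP existsP) => [[x /existsP[y /andP[xy /eqP->]]]|].
  by exists x, y.
by move=> [x [y [xy ->]]]; exists x; apply/existsP; exists y; rewrite xy eqxx.
Qed.

Lemma adj_neq x y : adj x y -> x != y.
Proof. by apply: contraTneq => ->; rewrite adj_irrefl. Qed.

Lemma edge_at (f : {set G}) x :
  f \in edges G -> x \in f -> exists2 y, adj x y & f = [set x; y].
Proof.
move=> /edgesP[a [b [ab ->]]]; rewrite !inE => /orP[] /eqP->; first by exists b.
by exists a; [rewrite adj_sym | rewrite setUC].
Qed.

Lemma matching_edge M (f : {set G}) : is_matching M -> f \in M -> f \in edges G.
Proof. by move=> /andP[/subsetP sM _] /sM. Qed.

Lemma matching_at_most_one M (f g : {set G}) x :
  is_matching M -> f \in M -> g \in M -> x \in f -> x \in g -> f = g.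
Proof.
move=> /andP[_ tM] fM gM xf xg.
by rewrite -(def_pblock tM fM xf) (def_pblock tM gM xg).
Qed.

Lemma matching_sub M N : is_matching M -> N \subset M -> is_matching N.
Proof.
by move=> /andP[sM tM] NM; rewrite /is_matching (subset_trans NM sM) (trivIsetS NM).
Qed.

Lemma card_cover_matching M : is_matching M -> #|cover M| = 2 * #|M|.
Proof.
move=> mM; have /andP[_ /eqP <-] := mM.
rewrite mulnC -sum_nat_const; apply: eq_bigr => f fM.
have /edgesP[x [y [xy ->]]] := matching_edge mM fM.
by rewrite cards2 adj_neq.
Qed.

Lemma matching_add M x y :
  is_matching M -> adj x y -> x \notin cover M -> y \notin cover M ->
  is_matching ([set x; y] |: M) /\ #|[set x; y] |: M| = #|M|.+1.
Proof.
move=> mM xy xM yM.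
have /andP[sM tM] := mM.
have dis f : f \in M -> [disjoint [set x; y] & f].
  move=> fM; rewrite disjoints_subset subUset !sub1set !inE.
  by apply/andP; split; [move: xM|move: yM]; apply: contra => h;
    apply/bigcupP; exists f.
have nM : [set x; y] \notin M.
  by apply: contra xM => h; apply/bigcupP; exists [set x; y]; rewrite ?set21.
split; last by rewrite cardsU1 nM.
apply/andP; split.
  rewrite subUset sM sub1set andbT; apply/edgesP; by exists x, y.
apply/trivIsetP => f g /setU1P[->|fM] /setU1P[->|gM] fg.
- by rewrite eqxx in fg.
- exact: dis.
- by rewrite disjoint_sym; apply: dis.
- by move/trivIsetP: tM; apply.
Qed.

Lemma leq_matching_number M : is_matching M -> #|M| <= matching_number G.
Proof. by move=> mM; apply: leq_bigmax_cond. Qed.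

Lemma maximum_matching_covers_edge M x y :
  is_maximum_matching M -> adj x y -> x \notin cover M -> y \in cover M.
Proof.
move=> /andP[mM /eqP cM] xy xM; apply/negPn/negP => yM.
have [m' c'] := matching_add mM xy xM yM.
by move: (leq_matching_number m'); rewrite c' cM ltnn.
Qed.

(** * Gallai's lemma *)

Definition never_missed_together x y :=
  forall M, is_maximum_matching M -> x \notin cover M -> y \notin cover M -> x = y.

(** Let [M] miss two distinct vertices [u] and [v]. Then [M] covers [t], and a
    maximum matching [N] missing [t] covers [u] and [v]. As [M] and [N] cover
    equally many vertices, [M] covers some vertex [x] other than [t] that [N]
    misses. If [xy] is the edge of [M] at [x] and [g] the edge of [N] at [y],
    replacing [g] by [xy] in [N] gives a maximum matching that still misses [t]
    and has one more edge in common with [M]; so an [N] sharing as many edges as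
    possible with [M] yields a contradiction. *)
Lemma never_missed_together_trans t u v :
  (exists2 N, is_maximum_matching N & t \notin cover N) ->
  never_missed_together u t -> never_missed_together t v ->
  never_missed_together u v.
Proof.
move=> [N0 mN0 tN0] ut tv M mM uM vM.
have [//|uv] := eqVneq u v.
have tM : t \in cover M.
  apply/negPn/negP => tM; move/eqP: uv; apply.
  by rewrite (ut _ mM uM tM) (tv _ mM tM vM).
have P0 : is_maximum_matching N0 && (t \notin cover N0) by rewrite mN0.
pose good N := is_maximum_matching N && (t \notin cover N).
case: (@arg_maxnP _ N0 good (fun N => #|M :&: N|) P0) => N /andP[mN tN] Nmax.
have uN : u \in cover N.
  by apply/negPn/negP => uN; move: tM uM; rewrite (ut _ mN uN tN) => ->.
have vN : v \in cover N.
  by apply/negPn/negP => vN; move: tM vM; rewrite (tv _ mN tN vN) => ->.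
have /andP[maM /eqP cM] := mM; have /andP[maN /eqP cN] := mN.
(* Both matchings have the same size, so these differences do too. *)
have AB : #|cover M :\: cover N| = #|cover N :\: cover M|.
  have covE : #|cover M| = #|cover N|.
    apply: etrans (card_cover_matching maM) _; rewrite cM -cN.
    exact/esym/card_cover_matching.
  by rewrite !cardsD covE setIC.
have A2 : 1 < #|cover N :\: cover M|.
  have <- : #|[set u; v]| = 2 by rewrite cards2 uv.
  by apply/subset_leq_card; rewrite subUset !sub1set !inE uN vN uM vM.
have [x] : exists x, x \in (cover M :\: cover N) :\ t.
  apply/card_gt0P; move: A2; rewrite -AB.
  by rewrite (cardsD1 t (cover M :\: cover N)) inE tM tN add1n ltnS.
rewrite !inE => /and3P[xt xN xM].
have /bigcupP[f fM xf] := xM.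
have [y xy fE] := edge_at (matching_edge maM fM) xf.
have yN := maximum_matching_covers_edge mN xy xN.
have /bigcupP[g gN yg] := yN.
have xN' : x \notin cover (N :\ g).
  apply: contra xN => /bigcupP[h /setD1P[_ hN] xh]; by apply/bigcupP; exists h.
have yN' : y \notin cover (N :\ g).
  apply/negP => /bigcupP[h /setD1P[hg hN] yh].
  by move: hg; rewrite (matching_at_most_one maN hN gN yh yg) eqxx.
have [mN' cN'] := matching_add (matching_sub maN (subsetDl N [set g]))
  xy xN' yN'.
set N' := _ |: _ in mN' cN'.
have gM : g \notin M.
  apply: contra xN => gM; have yf : y \in f by rewrite fE set22.
  by apply/bigcupP; exists g => //; rewrite -(matching_at_most_one maM fM gM yf yg).
have goodN' : good N'.
  rewrite /good /is_maximum_matching mN' cN'.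
  have -> : #|N :\ g|.+1 = matching_number G by rewrite -cN (cardsD1 g N) gN.
  rewrite eqxx /=.
  apply/negP => /bigcupP[h /setU1P[->|/setD1P[_ hN]] th]; last first.
    by case/negP: tN; apply/bigcupP; exists h.
  move: th; rewrite !inE eq_sym (negPf xt) /= => /eqP ty.
  by rewrite ty yN in tN.
have fN : f \notin N.
  by apply: contra xN => fN; apply/bigcupP; exists f.
have sub : f |: (M :&: N) \subset M :&: N'.
  rewrite subUset sub1set !inE fM fE eqxx /=; apply/subsetP => h.
  rewrite !inE => /andP[hM hN]; rewrite hM hN andbT /=.
  by rewrite orbC (contraNneq _ gM) // => <-.
have := leq_trans (subset_leq_card sub) (Nmax _ goodN').
by rewrite cardsU1 inE (negPf fN) andbF add1n ltnn.
Qed.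

Lemma connect_never_missed_together x y :
  (forall t, exists2 N, is_maximum_matching N & t \notin cover N) ->
  connect adj x y -> never_missed_together x y.
Proof.
move=> all_missed /connectP[p]; elim: p x => [|z p IH] x /=.
  by move=> _ -> M.
case/andP=> xz pz yE.
apply: (never_missed_together_trans (all_missed z)); last exact: IH.
by move=> M mM xM; rewrite (maximum_matching_covers_edge mM xz).
Qed.

(** * Components *)

Lemma component_connect (C : {set G}) x :
  C \in components G -> x \in C -> C = [set y | connect adj x y].
Proof.
have cs := sym_connect_sym (@adj_sym G).
move=> /imsetP[x0 _ ->]; rewrite !inE => x0x; apply/setP => y.
by rewrite !inE (same_connect cs x0x).
Qed.

Lemma components_partition : partition (components G) [set: G].
Proof.
apply: equivalence_partitionP => x y z _ _ _; split=> // xy.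
exact: (same_connect (sym_connect_sym (@adj_sym G)) xy).
Qed.

Lemma component_nonempty (C : {set G}) : C \in components G -> exists x, x \in C.
Proof.
move=> CG; have /and3P[_ _ n0] := components_partition.
by apply/set0Pn; apply: contraNneq n0 => <-.
Qed.

(** An edge meeting a component lies inside it, so the vertices in question are
    those covered by a smaller matching. *)
Lemma component_cover_even (C : {set G}) M :
  C \in components G -> is_matching M -> ~~ odd #|C :&: cover M|.
Proof.
move=> CG mM; pose MC := [set f in M | f \subset C].
have mMC : is_matching MC.
  by apply: matching_sub mM _; apply/subsetP => f; rewrite inE => /andP[].
suff -> : C :&: cover M = cover MC by rewrite card_cover_matching // mul2n odd_double.
apply/setP => x; rewrite inE; apply/andP/bigcupP => [[xC /bigcupP[f fM xf]]|].
  exists f => //; rewrite inE fM /=.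
  have [y xy ->] := edge_at (matching_edge mM fM) xf.
  by rewrite subUset !sub1set xC (component_connect CG xC) inE connect1.
move=> [f]; rewrite inE => /andP[fM /subsetP fC] xf.
by split; [exact: fC | apply/bigcupP; exists f].
Qed.

(** The equality case, a vertex joined to all the rest of its component, is what makes the components complete. *)
Lemma degree_component (C : {set G}) x :
  C \in components G -> x \in C ->
  degree x <= #|C|.-1 ?= iff [forall y in C, (x != y) ==> adj x y].
Proof.
move=> CG xC.
have sub : [set y | adj x y] \subset C :\ x.
  apply/subsetP => y; rewrite !inE => xy; rewrite eq_sym adj_neq //=.
  by rewrite (component_connect CG xC) inE connect1.
have -> : #|C|.-1 = #|C :\ x| by rewrite (cardsD1 x C) xC.
rewrite /degree; have [le eqC] := subset_leqif_card sub.
split=> //; rewrite eqC; apply/subsetP/'forall_implyP => h y.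
  by move=> yC; apply/implyP => xy; have := h y; rewrite !inE eq_sym xy yC; apply.
by rewrite !inE => /andP[yx yC]; move: (h y yC); rewrite eq_sym yx.
Qed.

End Matchings.

Lemma complete_isomorphic (H : sgraph) n :
  #|H| = n -> (forall x y : H, adj x y = (x != y)) ->
  isomorphic H (complete_graph n).
Proof.
move=> <- adjE; exists (@enum_rank H); first exact: enum_rank_bij.
by move=> x y; rewrite adjE /adj /= /complete_adj (inj_eq enum_rank_inj).
Qed.

(** * Partitions of the edge set into matchings *)

Section MatchingPartition.
Variables (G : sgraph) (P : {set {set {set G}}}).
Hypothesis partP : partition P (edges G).

Lemma partition_edge_colorable :
  (forall M, M \in P -> is_matching M) -> edge_colorable G #|P|.
Proof.
move=> mP; have /and3P[/eqP covP tP _] := partP.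
have inP (f : {f | f \in edges G}) : pblock P (val f) \in P.
  by rewrite pblock_mem // covP (valP f).
apply/existsP; exists [ffun f => enum_rank_in (inP f) (pblock P (val f))].
apply/'forall_forallP => f g; apply/implyP => /andP[fg]; apply: contra.
rewrite !ffunE => /eqP /(congr1 enum_val); rewrite !enum_rankK_in // => fgE.
rewrite -setI_eq0; apply: contraR fg => /set0Pn[x /setIP[xf xg]].
have fM : val f \in pblock P (val f) by rewrite mem_pblock covP (valP f).
have gM : val g \in pblock P (val f) by rewrite fgE mem_pblock covP (valP g).
by apply/eqP/val_inj; rewrite /= (matching_at_most_one (mP _ (inP f)) fM gM xf xg).
Qed.

(** The part containing an edge is determined by that edge, and a part covers a
    vertex through one of the edges at that vertex. *)
Lemma card_covering_parts (x : G) :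
  #|[set M in P | x \in cover M]| <= degree x.
Proof.
have /and3P[/eqP covP tP _] := partP.
rewrite /degree; pose part y := pblock P [set x; y].
apply: leq_trans (leq_imset_card part _).
apply/subset_leq_card/subsetP => M; rewrite inE => /andP[MP /bigcupP[f fM xf]].
have fE : f \in edges G by rewrite -covP; apply/bigcupP; exists M.
have [y xy fxy] := edge_at fE xf.
apply/imsetP; exists y; first by rewrite inE.
by rewrite /part -fxy (def_pblock tP MP fM).
Qed.

Definition missing_parts (x : G) := [set M in P | x \notin cover M].

Lemma card_missing_parts x : #|P| <= #|missing_parts x| + degree x.
Proof.
rewrite -(cardsID [set M : {set {set G}} | x \in cover M] P) addnC.
apply: leq_add.
  by apply/subset_leq_card/subsetP => M; rewrite !inE andbC.
apply: leq_trans (card_covering_parts x).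
by apply/subset_leq_card/subsetP => M; rewrite !inE andbC.
Qed.

End MatchingPartition.

(** * Components when every vertex is missed *)

Section MaximumMatchingPartition.
Variables (G : sgraph) (P : {set {set {set G}}}).
Hypothesis partP : partition P (edges G).
Hypothesis maxP : forall M, M \in P -> is_maximum_matching M.
Hypothesis max_degree_lt : max_degree G < #|P|.

Lemma part_matching M : M \in P -> is_matching M.
Proof. by move=> MP; have /andP[] := maxP MP. Qed.

Lemma missing_parts_gt0 x : 0 < #|missing_parts P x|.
Proof.
have degD : degree x <= max_degree G by rewrite /max_degree leq_bigmax.
have := card_missing_parts partP x; lia.
Qed.

Lemma missed_by_maximum_matching (x : G) :
  exists2 M, is_maximum_matching M & x \notin cover M.
Proof.
have /card_gt0P[M] := missing_parts_gt0 x.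
by rewrite inE => /andP[/maxP]; exists M.
Qed.

(** Connected vertices are never missed together, so a part misses at most one
    vertex of [C]. It misses an even number of them exactly when [#|C|] is even;
    as some part does miss a vertex of [C], [#|C|] is odd and no part can miss
    none. *)
Lemma component_missed_once (C : {set G}) M :
  C \in components G -> M \in P -> #|C :\: cover M| = 1.
Proof.
move=> CG MP.
have missed_le1 N : N \in P -> #|C :\: cover N| <= 1.
  move=> NP; rewrite leqNgt; apply/negP => /card_gt1P[x [y []]].
  rewrite !inE => /andP[xN xC] /andP[yN yC] /eqP; apply.
  apply: (connect_never_missed_together missed_by_maximum_matching _ (maxP NP)) => //.
  by move: yC; rewrite (component_connect CG xC) inE.
have odd_missed N : N \in P -> odd #|C :\: cover N| = odd #|C|.
  move=> NP; rewrite -(cardsID (cover N) C) oddD.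
  by rewrite (negPf (component_cover_even CG (part_matching NP))).
have oddC : odd #|C|.
  have [x xC] := component_nonempty CG.
  have /card_gt0P[N] := missing_parts_gt0 x; rewrite inE => /andP[NP xN].
  rewrite -(odd_missed N NP); suff -> : #|C :\: cover N| = 1 by [].
  apply/eqP; rewrite eqn_leq missed_le1 //=.
  by apply/card_gt0P; exists x; rewrite inE xN.
by move: (missed_le1 M MP) (odd_missed M MP); rewrite oddC; case: #|C :\: _| => [|[]].
Qed.

Lemma component_odd (C : {set G}) : C \in components G -> odd #|C|.
Proof.
move=> CG; have [M MP] : exists M, M \in P.
  by apply/card_gt0P; apply: leq_trans max_degree_lt.
rewrite -(cardsID (cover M) C) component_missed_once // oddD.
by rewrite (negPf (component_cover_even CG (part_matching MP))).
Qed.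

Lemma sum_missing_parts (C : {set G}) :
  C \in components G -> \sum_(x in C) #|missing_parts P x| = #|P|.
Proof.
move=> CG.
transitivity (\sum_(x in C) \sum_(M in P) (x \notin cover M : nat)).
  apply: eq_bigr => x _; rewrite -sum1_card -big_mkcondr /=.
  by apply: eq_bigl => M; rewrite inE.
rewrite exchange_big /= -sum1_card; apply: eq_bigr => M MP.
rewrite -(component_missed_once CG MP) -sum1_card -big_mkcondr /=.
by apply: eq_bigl => x; rewrite inE andbC.
Qed.

(** Write [c] for [#|C|] and [k] for [#|P|]. Every vertex of [C] is missed by at
    least one part, whence [c <= k], and, its degree being at most [c - 1], by at
    least [k + 1 - c] parts, whence [c * (k + 1 - c) <= k], that is
    [(c - 1) * (k - c) <= 0]. Here [c > 1], since no vertex is isolated. *)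
Lemma component_card (C : {set G}) :
  no_isolated_vertex G -> C \in components G -> #|C| = #|P|.
Proof.
move=> noiso CG.
have degC z : z \in C -> degree z <= #|C|.-1.
  by move=> zC; have [] := degree_component CG zC.
have leCP : #|C| <= #|P|.
  rewrite -(sum_missing_parts CG) -sum1_card; apply: leq_sum => z _.
  exact: missing_parts_gt0.
have C1 : 1 < #|C|.
  have [x xC] := component_nonempty CG; have [y xy] := noiso x.
  have : 0 < degree x by apply/card_gt0P; exists y; rewrite inE.
  have := degC x xC; lia.
have : \sum_(z in C) (#|P|.+1 - #|C|) <= #|P|.
  rewrite -{2}(sum_missing_parts CG); apply: leq_sum => z zC.
  have := card_missing_parts partP z; have := degC z zC; lia.
rewrite sum_nat_const; nia.
Qed.

(** With as many vertices as parts, each missed at least once and [#|P|] times in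
    all, every vertex is missed exactly once. *)
Lemma component_degree (C : {set G}) x :
  no_isolated_vertex G -> C \in components G -> x \in C -> degree x = #|P|.-1.
Proof.
move=> noiso CG xC; have CP := component_card noiso CG.
have missing1 : #|missing_parts P x| <= 1.
  have := sum_missing_parts CG; rewrite (bigD1 x) //=.
  have : \sum_(z in C | z != x) 1 <= \sum_(z in C | z != x) #|missing_parts P z|.
    by apply: leq_sum => z _; apply: missing_parts_gt0.
  have -> : \sum_(z in C | z != x) 1 = #|P|.-1.
    by rewrite -CP -[#|C|]sum1_card [in RHS](bigD1 x).
  move: max_degree_lt; move: (\sum_(_ in _ | _) _) #|missing_parts P x| #|P|.
  move=> S m p; lia.
have := card_missing_parts partP x; have [] := degree_component CG xC; lia.
Qed.

(** A part leaves exactly one vertex of each component uncovered. *)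
Lemma card_cover_part n M :
  (forall C, C \in components G -> #|C| = n.+1) -> M \in P ->
  #|cover M| = #|components G| * n.
Proof.
move=> cardC MP; have /and3P[/eqP covC tC _] := components_partition G.
rewrite -sum_nat_const -sum1_card.
have -> : \sum_(x in cover M) 1 =
    \sum_(x in cover (components G)) (x \in cover M : nat).
  by rewrite -big_mkcondr covC /=; apply: eq_bigl => x; rewrite inE.
rewrite big_trivIset //=; apply: eq_bigr => C CG.
have := component_missed_once CG MP; have := cardC C CG.
rewrite -(cardsID (cover M) C) -big_mkcondr /= => + D1; rewrite D1.
by rewrite -sum1_card addn1 => -[<-]; apply: eq_bigl => x; rewrite inE.
Qed.

End MaximumMatchingPartition.

Theorem theorem2 (G : sgraph)
    (hG : no_isolated_vertex G)
    (hII : class_II G)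
    (hP : exists P : {set {set {set G}}},
        partition P (edges G) /\
        (forall M, M \in P -> is_maximum_matching M)) :
  [/\ ~~ odd (max_degree G),
      (#|components G|%:R = (2 * matching_number G)%:R / (max_degree G)%:R
         :> rat)%R
    & forall C, C \in components G ->
        isomorphic (induced C) (complete_graph (max_degree G).+1)].
Proof.
have [P [partP maxP]] := hP.
have max_degree_lt : max_degree G < #|P|.
  have := partition_edge_colorable partP (part_matching maxP).
  rewrite -hII /chromatic_index; case: ex_minnP => m _ min_m; exact: min_m.
have [M MP] : exists M, M \in P.
  by apply/card_gt0P; apply: leq_trans max_degree_lt.
have [x0 _] : exists x : G, true.
  have /and3P[_ _ n0] := partP.
  have /set0Pn[f fM] : M != set0 by apply: contraNneq n0 => <-.
  by have /edgesP[x _] := matching_edge (part_matching maxP MP) fM; exists x.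
have /and3P[/eqP covC _ _] := components_partition G.
have /bigcupP[C0 C0G x0C] : x0 \in cover (components G) by rewrite covC inE.
have degP (x : G) C : C \in components G -> x \in C -> degree x = #|P|.-1.
  exact: component_degree.
have DE : max_degree G = #|P|.-1.
  have : degree x0 <= max_degree G by rewrite /max_degree leq_bigmax.
  by rewrite (degP x0 C0) //; lia.
have D0 : 0 < max_degree G.
  have [y xy] := hG x0; rewrite DE -(degP x0 C0) //.
  by apply/card_gt0P; exists y; rewrite inE.
have cardC (C : {set G}) : C \in components G -> #|C| = (max_degree G).+1.
  by move=> CG; rewrite (component_card partP maxP max_degree_lt hG CG); lia.
split.
- by have := component_odd partP maxP max_degree_lt C0G; rewrite cardC.
- have /andP[mM /eqP <-] := maxP M MP; rewrite -(card_cover_matching mM).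
  rewrite (card_cover_part partP maxP max_degree_lt cardC MP).
  by rewrite GRing.natrM GRing.mulfK // Num.Theory.pnatr_eq0 -lt0n.
- move=> C CG; apply: complete_isomorphic.
    by rewrite card_sig -(cardC C CG); apply: eq_card.
  move=> [x xC] [y yC]; rewrite /adj /= /induced_adj /=.
  have [_ eqd] := degree_component CG xC.
  have : [forall y in C, (x != y) ==> adj x y].
    by rewrite -eqd (degP x C) // cardC // DE.
  move=> /'forall_implyP/(_ y yC)/implyP xy.
  apply/idP/idP => [/adj_neq|nxy]; first by apply: contraNneq => -[->].
  by apply: xy; apply: contraNneq nxy => xyE; apply/eqP/val_inj.
Qed.
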